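(* Let $n \ge 1$ and $k \ge 0$ be integers. In the game Permutation Wordle on $[n]$, the number of secret permutations $\sigma \in S_n$ that the strategy CircularShift solves in exactly $k+1$ guesses is the Eulerian number $A(n,k)$.
   Context: Let $[n]=\{1,\dots,n\}$ and let $S_n$ be the group of permutations of $[n]$. Permutation Wordle: a setter fixes a secret $\sigma\in S_n$. In round $r=1,2,\dots$ the guesser submits a word $\gamma_r\in[n]^n$, regarded as a function $\gamma_r:[n]\to[n]$ from positions to values, and receives the feedback $U_r=\{i\in[n] : \gamma_r(i)=\sigma(i)\}$. The guess $\gamma_{r+1}$ may depend on $U_1,\dots,U_r$. The secret is solved in exactly $r$ guesses if $\gamma_r=\sigma$ and $\gamma_j\ne\sigma$ for all $j<r$. CircularShift is the following deterministic strategy. The first guess $\gamma_1$ is the identity permutation. After submitting $\gamma_r$ and receiving $U_r$: if $U_r=[n]$, stop (the secret is solved in $r$ rounds). Otherwise write $[n]\setminus U_r=\{a_1<\cdots<a_\ell\}$ and define $\gamma_{r+1}(i)=\gamma_r(i)$ if $i\in U_r$; $\gamma_{r+1}(a_j)=\gamma_r(a_{j-1})$ for $1<j\le \ell$; and $\gamma_{r+1}(a_1)=\gamma_r(a_\ell)$. An excedance of $\pi\in S_n$ is a position $i\in[n]$ with $\pi(i)>i$; $\mathrm{exc}(\pi)$ is the number of excedances of $\pi$. The Eulerian number is $A(n,k)=|\{\pi\in S_n : \mathrm{exc}(\pi)=k\}|$. *)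

(* Defs.v *)
From mathcomp Require Import all_boot all_fingroup.

Set Implicit Arguments.
Unset Strict Implicit.
Unset Printing Implicit Defensive.

(* Positions and values both range over 'I_n = {0, ..., n-1}, which stands for
   [n] = {1, ..., n} through the order isomorphism i |-> i + 1. *)
Definition word (n : nat) := {ffun 'I_n -> 'I_n}.

Definition feedback n (sigma : 'S_n) (g : word n) : {set 'I_n} :=
  [set i | g i == sigma i].

(* A deterministic strategy sends the feedback U_1, ..., U_r received so far
   (oldest first) to the guess submitted in round r + 1. *)
Definition strategy (n : nat) := seq {set 'I_n} -> word n.

(* The feedback U_1, ..., U_r of the first r rounds against sigma. *)
Fixpoint feedbacks n (G : strategy n) (sigma : 'S_n) (r : nat) :
    seq {set 'I_n} :=
  if r is r'.+1 then
    let h := feedbacks G sigma r' in rcons h (feedback sigma (G h))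
  else [::].

(* Rounds are numbered from 1; round 0 is meaningless. *)
Definition guess n (G : strategy n) (sigma : 'S_n) (r : nat) : word n :=
  G (feedbacks G sigma r.-1).

Definition solved_in n (G : strategy n) (sigma : 'S_n) (r : nat) : bool :=
  [&& 0 < r, guess G sigma r == finfun sigma
    & all (fun j => guess G sigma j != finfun sigma) (iota 1 r.-1)].

(* enum (~: U) lists the elements a_1 < ... < a_l outside U in increasing order,
   and prev is the predecessor in this list read cyclically: it sends a_j to
   a_(j-1) for j > 1 and a_1 to a_l. *)
Definition circular_step n (g : word n) (U : {set 'I_n}) : word n :=
  [ffun i => if i \in U then g i else g (prev (enum (~: U)) i)].

(* Instead of stopping, the strategy repeats its guess once U is everything;
   solved_in only looks at the first correct guess, so this is immaterial. *)
Definition circular_shift n : strategy n :=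
  foldl (@circular_step n) [ffun i => i].

Definition exc n (pi : 'S_n) : nat := #|[set i : 'I_n | i < pi i]|.

Definition eulerian (n k : nat) : nat := #|[set pi : 'S_n | exc pi == k]|.

(* Main.v *)
Require Import Defs.
From mathcomp Require Import all_boot all_fingroup.

Set Implicit Arguments.
Unset Strict Implicit.
Unset Printing Implicit Defensive.

(** The statement holds permutation by permutation: CircularShift solves
    [sigma] in exactly [exc sigma + 1] guesses.

    Read a guess [g] as a placement of the values, the value [g i] sitting at
    position [i] and wanting to reach its home [sigma^-1 (g i)]; let [h] send
    [i] to that home.  The guess is correct iff [h] is the identity, which for
    an injective [h] means that no position [i] has [h i < i] ([aexc_eq0]).
    On the circle, [h i < i] says that the value at [i], travelling forwards,
    still has to cross the cut between the last and the first position.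

    A round moves every misplaced value to the next misplaced position, the
    values already home staying put.  A misplaced value has its home among the
    misplaced positions, so it can reach its home but not jump over it, and
    its need to cross the cut is unaffected by a move that does not cross the
    cut.  Exactly one value does cross it: the one at the last misplaced
    position.  So the number of values that have still to cross drops by
    exactly one per round ([aexc_shift]).  It is initially [exc sigma], and the
    secret is found when it is zero. *)

(** The number of values that have yet to cross the cut, for the map [h] from
    positions to homes; for a permutation, its number of anti-excedances. *)
Definition aexc n (h : 'I_n -> 'I_n) : nat := #|[set i : 'I_n | h i < i]|.

Definition misplaced n (h : 'I_n -> 'I_n) : seq 'I_n :=
  enum [set i | h i != i].

(** The sum of all [h i] equals the sum of all [i], so [i <= h i] everywhere
    forces equality everywhere. *)
Lemma aexc_eq0 n (h : 'I_n -> 'I_n) :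
  injective h -> (aexc h == 0) = [forall i, h i == i].
Proof.
move=> h_inj; apply/idP/forallP => [|h_id]; last first.
  rewrite cards_eq0; apply/eqP/setP=> i.
  by rewrite !inE (eqP (h_id i)) ltnn.
rewrite cards_eq0 => /eqP h_ge i.
have le_h (j : 'I_n) : true -> j <= h j ?= iff (j == h j).
  move=> _; split=> //; rewrite leqNgt; apply/negP=> h_lt.
  by have := in_set0 j; rewrite -h_ge inE h_lt.
have [_] := leqif_sum le_h.
rewrite [X in _ == X](_ : _ = \sum_(j < n) j); last first.
  by rewrite [RHS](reindex h) //; exact/onW_bij/injF_bij.
by rewrite eqxx => /esym/forallP/(_ i); rewrite eq_sym.
Qed.

Lemma sorted_enum_ord n (A : {set 'I_n}) :
  sorted (fun i j : 'I_n => i < j) (enum A).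
Proof.
have ltn_tr : transitive (fun i j : 'I_n => i < j).
  by move=> j i k; apply: ltn_trans.
rewrite {1}/enum_mem; apply: sorted_filter => //.
rewrite -enumT; have := iota_ltn_sorted 0 n.
by rewrite -val_enum_ord sorted_map.
Qed.

(** In an increasing list read cyclically, a move from [j] to its successor
    crosses no element of the list, except that the last element wraps around
    to the first.  Hence [x] stays on the same side unless [j] is last. *)
Lemma ltn_next_sorted n (s : seq 'I_n) (x0 j x : 'I_n) :
  sorted (fun i j : 'I_n => i < j) s -> j \in s -> x \in s -> x != j ->
  (x < next s j) = (x < j) && (j != last x0 s).
Proof.
move=> s_sorted j_s; case/splitPr: j_s s_sorted => p1 p2.
rewrite sorted_pairwise; last by move=> b a c; apply: ltn_trans.
rewrite pairwise_cat pairwise_cons allrel_consr.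
case/and3P=> /andP[p1_lt_j p1_lt_p2] p1_inc /andP[j_lt_p2 p2_inc].
have j_p1 : j \notin p1.
  by apply/negP=> /(allP p1_lt_j); rewrite ltnn.
have next_j : next (p1 ++ j :: p2) j = head (head j p1) p2.
  rewrite next_nth mem_cat mem_head orbT.
  case: p1 j_p1 {p1_lt_j p1_lt_p2 p1_inc} => [|y p1] /= j_p1.
    by rewrite eqxx; case: p2 {j_lt_p2 p2_inc}.
  move: j_p1; rewrite inE negb_or => /andP[j_neq_y j_p1].
  rewrite eq_sym (negPf j_neq_y) index_cat (negPf j_p1) /= eqxx addn0.
  by rewrite nth_cat ltnNge leqnSn /= subSnn; case: p2 {j_lt_p2 p2_inc}.
rewrite next_j last_cat /= mem_cat inE => x_s x_neq_j.
rewrite (negPf x_neq_j) /= in x_s.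
case: p2 j_lt_p2 p2_inc p1_lt_p2 x_s {next_j} => [|y p2] /=.
  move=> _ _ _; rewrite orbF eqxx andbF => x_p1.
  (* [j] is last: its successor is the minimum of the list. *)
  case: p1 x_p1 p1_inc {p1_lt_j j_p1} => //= y p1.
  rewrite inE => /predU1P[->|x_p1]; first by rewrite ltnn.
  by case/andP=> /allP/(_ _ x_p1) lt_yx _; rewrite ltnNge (ltnW lt_yx).
case/andP=> lt_jy /allP j_lt_p2 /andP[/allP y_lt_p2 _] _ x_s.
have -> : j != last y p2.
  apply/eqP=> j_last; have := mem_last y p2; rewrite -j_last inE.
  case/predU1P=> [j_y|/j_lt_p2]; last by rewrite ltnn.
  by rewrite j_y ltnn in lt_jy.
rewrite andbT; case/orP: x_s => [/(allP p1_lt_j) lt_xj|].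
  by rewrite lt_xj (ltn_trans lt_xj lt_jy).
rewrite inE => /predU1P[->|x_p2].
  by rewrite ltnn ltnNge (ltnW lt_jy).
by rewrite !ltnNge (ltnW (y_lt_p2 _ x_p2)) (ltnW (j_lt_p2 _ x_p2)).
Qed.

Lemma leq_last_sorted n (s : seq 'I_n) (x0 x : 'I_n) :
  sorted (fun i j : 'I_n => i < j) s -> x \in s -> x <= last x0 s.
Proof.
case/lastP: s => [|s y] //.
rewrite sorted_pairwise; last by move=> b a c; apply: ltn_trans.
rewrite pairwise_rcons last_rcons mem_rcons inE => /andP[s_lt _].
by case/predU1P=> [->//|/(allP s_lt)/ltnW].
Qed.

(** One round of the game, seen on the map from positions to homes: exactly
    one value crosses the cut, the one at the last misplaced position.  The
    truncated predecessor also covers the solved game, where nothing moves. *)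
Lemma aexc_shift n (h : 'I_n -> 'I_n) :
  injective h -> aexc (h \o prev (misplaced h)) = (aexc h).-1.
Proof.
move=> h_inj; pose s := misplaced h.
have s_uniq : uniq s by exact: enum_uniq.
have s_sorted := sorted_enum_ord [set i | h i != i].
have mem_s i : (i \in s) = (h i != i) by rewrite mem_enum inE.
have h_s i : i \in s -> h i \in s by rewrite !mem_s (inj_eq h_inj).
have -> : aexc (h \o prev s) = #|[set j | h j < next s j]|.
  rewrite /aexc -[LHS](card_imset _ (can_inj (next_prev s_uniq))).
  apply: eq_card => j; apply/imsetP/idP => [[i]|].
    by rewrite !inE /= => lt_i ->; rewrite next_prev.
  rewrite inE => lt_j; exists (next s j); last by rewrite prev_next.
  by rewrite inE /= prev_next.
have fixed_case j : j \notin s -> h j = j by rewrite mem_s negbK => /eqP.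
have next_fixed j : j \notin s -> next s j = j.
  by move=> j_s; rewrite next_nth (negPf j_s).
case s_def: s => [|x0 s'].
  have not_s j : j \notin s by rewrite s_def.
  have set_0 (f : 'I_n -> 'I_n) : f =1 id -> [set j | h j < f j] = set0.
    by move=> f_id; apply/setP=> j; rewrite !inE f_id fixed_case ?ltnn.
  by rewrite -s_def set_0 => [|j]; rewrite /aexc ?(set_0 id) ?cards0 ?next_fixed.
pose m := last x0 s.
have m_s : m \in s by rewrite /m s_def /= mem_last.
have h_m : h m < m.
  rewrite ltn_neqAle leq_last_sorted ?h_s // andbT.
  by rewrite -mem_s.
rewrite -s_def /aexc (cardsD1 m [set i | h i < i]) inE h_m add1n /=.
apply: eq_card => j; rewrite !inE andbC.
have [j_s|j_s] := boolP (j \in s).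
  by apply: ltn_next_sorted; rewrite ?h_s // -mem_s.
by rewrite next_fixed // fixed_case // ltnn.
Qed.

(** The values at the positions outside the listed ones do not move, as [prev]
    is the identity there; so the step is one composition with [prev]. *)
Lemma circular_stepE n (g : word n) (U : {set 'I_n}) :
  circular_step g U =1 g \o prev (enum (~: U)).
Proof.
move=> i; rewrite ffunE /=; case: ifP => // i_U.
by rewrite prev_nth mem_enum inE i_U.
Qed.

Section Play.

Variables (n : nat) (sigma : 'S_n).

Definition home (g : word n) (i : 'I_n) : 'I_n := (sigma^-1)%g (g i).

Lemma home_inj (g : word n) : injective g -> injective (home g).
Proof. by move=> g_inj; apply: inj_comp => //; exact: perm_inj. Qed.

Lemma home_fix (g : word n) i : (home g i == i) = (g i == sigma i).
Proof. by rewrite -(inj_eq (@perm_inj _ sigma)) /home permKV. Qed.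

Lemma home_step (g : word n) :
  home (circular_step g (feedback sigma g)) =1
  home g \o prev (misplaced (home g)).
Proof.
move=> i; rewrite /home circular_stepE /= /misplaced.
rewrite (_ : ~: feedback sigma g = [set j | home g j != j]) //.
by apply/setP=> j; rewrite !inE home_fix.
Qed.

Lemma circular_step_inj (g : word n) U :
  injective g -> injective (circular_step g U).
Proof.
move=> g_inj; apply: eq_inj (fsym (circular_stepE g U)).
by apply: inj_comp => //; apply: can_inj (next_prev (enum_uniq _)).
Qed.

Lemma eq_aexc (h h' : 'I_n -> 'I_n) : h =1 h' -> aexc h = aexc h'.
Proof. by move=> eq_h; apply: eq_card => i; rewrite !inE eq_h. Qed.

Lemma guess_succ r :
  guess (@circular_shift n) sigma r.+2 =
  circular_step (guess (@circular_shift n) sigma r.+1)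
    (feedback sigma (guess (@circular_shift n) sigma r.+1)).
Proof. by rewrite /guess /= {1}/circular_shift foldl_rcons. Qed.

Lemma guess_inj r : injective (guess (@circular_shift n) sigma r.+1).
Proof.
elim: r => [|r IHr]; last by rewrite guess_succ; apply: circular_step_inj.
by move=> i j; rewrite /guess /= !ffunE.
Qed.

(** The identity guess puts each value [v] at position [v], so the values that
    have to cross the cut are the [v = sigma i] with [i < sigma i]. *)
Lemma aexc_guess r :
  aexc (home (guess (@circular_shift n) sigma r.+1)) = exc sigma - r.
Proof.
elim: r => [|r IHr]; last first.
  rewrite guess_succ (eq_aexc (home_step _)) aexc_shift ?IHr ?subnS //.
  exact/home_inj/guess_inj.
rewrite subn0 /exc -[RHS](card_imset _ (@perm_inj _ sigma)).
apply: eq_card => v; rewrite inE /home /guess /= ffunE.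
apply/idP/imsetP => [lt_v|[i]].
  by exists ((sigma^-1)%g v); rewrite ?inE permKV.
by rewrite inE => lt_i ->; rewrite permK.
Qed.

Lemma guess_correct r :
  (guess (@circular_shift n) sigma r.+1 == finfun sigma) = (exc sigma <= r).
Proof.
rewrite -subn_eq0 -aexc_guess aexc_eq0; last exact/home_inj/guess_inj.
apply/eqP/forallP => [-> i|h_id]; first by rewrite home_fix ffunE.
by apply/ffunP=> i; rewrite ffunE; apply/eqP; rewrite -home_fix.
Qed.

Lemma solved_in_exc k :
  solved_in (@circular_shift n) sigma k.+1 = (exc sigma == k).
Proof.
rewrite /solved_in /= guess_correct.
apply/andP/eqP => [[le_k /allP wrong]|<-]; last first.
  split=> //; apply/allP=> -[|j]; rewrite mem_iota // add1n => /andP[_ lt_j].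
  by rewrite guess_correct -ltnNge.
apply/eqP; rewrite eqn_leq le_k; case: k le_k wrong => // k _ wrong.
by have := wrong k.+1; rewrite mem_iota add1n ltnSn guess_correct -ltnNge; apply.
Qed.

End Play.

Theorem theorem7 (n k : nat) (hn : 0 < n) :
  #|[set sigma : 'S_n | solved_in (@circular_shift n) sigma k.+1]|
    = eulerian n k.
Proof. by apply: eq_card => sigma; rewrite !inE solved_in_exc. Qed.
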